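(* Let $T:\mathcal N^{k+1}\to\mathcal N$ be a locally contractive functor. Then $T$ admits a parameterised fixed point: a pair $(T^{\dagger\!\!\flat},\phi^T)$ — written $(T^{\epsilon},\phi^T)$ — such that $T^{\epsilon}:\mathcal N^k\to\mathcal N$ is a locally contractive functor, $\phi^T:T\circ\langle\mathrm{id},T^{\epsilon}\rangle\Rightarrow T^{\epsilon}$ is a natural isomorphism, and for every object $\vec F$ of $\mathcal N^k$, $(T^{\epsilon}\vec F,\phi^T_{\vec F})$ is a fixed point of $T(\vec F,-):\mathcal N\to\mathcal N$ (i.e. $\phi^T_{\vec F}:T(\vec F,T^{\epsilon}\vec F)\to T^{\epsilon}\vec F$ is an isomorphism).
   Context: $\mathcal N=\mathbf{Coiso}^{\mathbb N^{\mathrm{op}}}$ ($\mathbf{Coiso}$: countably-dimensional Hilbert spaces and coisometries); objects are Hilbert spaces $X(n)$ with coisometries $r^X_n:X(n+1)\to X(n)$, morphisms natural transformations. $\mathcal S=\mathbf{Set}^{\mathbb N^{\mathrm{op}}}$; the later functor $L^{\mathcal S}$ sets $LX(0)$ a singleton, $LX(n+1)=X(n)$ (restrictions shifted), and $\nu:\mathrm{id}\Rightarrow L^{\mathcal S}$ has $\nu_{X,0}$ the unique map and $\nu_{X,n+1}=r^X_n$. $\mathcal N$ is $\mathcal S$-enriched: $\mathcal N(X,Y)(n)$ is the set of $n$-th components of morphisms $X\to Y$, restriction $h\mapsto r^Y_n\circ h\circ(r^X_n)^\dagger$, componentwise composition. An $\mathcal S$-enriched endofunctor $F$ of $\mathcal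 N$ is locally contractive if there are $G_{X,Y}:L^{\mathcal S}\mathcal N(X,Y)\to\mathcal N(FX,FY)$ in $\mathcal S$ with $F_{X,Y}=G_{X,Y}\circ\nu_{\mathcal N(X,Y)}$, compatible with composition and identities. An $\mathcal S$-functor $T:\mathcal N^{m}\to\mathcal N$ is locally contractive if it is locally contractive separately in each variable: for every choice of objects in all but one argument, the resulting endofunctor $\mathcal N\to\mathcal N$ is locally contractive. A fixed point of an endofunctor $F$ is a pair $(X,\alpha:FX\to X)$ with $\alpha$ an isomorphism. *)

(* Defs.v *)
From HB Require Import structures.
From mathcomp Require Import all_boot all_order all_algebra.
From mathcomp Require Import sesquilinear complex.
From mathcomp Require Import all_classical all_reals all_analysis.

Set Implicit Arguments.
Unset Strict Implicit.
Unset Printing Implicit Defensive.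

Import Order.TTheory GRing.Theory Num.Theory.
Import numFieldNormedType.Exports.

Local Open Scope classical_set_scope.
Local Open Scope ring_scope.

Definition linear_span (K : numFieldType) (V : lmodType K) (B : set V) : set V :=
  [set v | exists s : seq (K * V),
      (forall p, p \in s -> B p.2) /\ v = \sum_(p <- s) p.1 *: p.2].

Definition orthonormal_basis (R : realType) (H : completeNormedModType R[i])
    (ip : H -> H -> R[i]) (B : set H) : Prop :=
  (forall u v, B u -> B v -> ip u v = (u == v)%:R) /\
  closure (linear_span B) = [set: H].

(* [countable] includes the finite cardinalities: finite-dimensional spaces,
   and the zero space, are countably-dimensional. *)
Record hilbert (R : realType) := Hilbert {
  hcarrier :> completeNormedModType R[i];
  inner : {dot hcarrier for (@Num.conj R[i])};
  inner_norm : forall x : hcarrier, inner x x = `|x| ^+ 2;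
  countably_dimensional :
    exists2 B : set hcarrier, countable B & orthonormal_basis inner B
}.

Definition is_adjoint (R : realType) (H K : hilbert R)
    (f : H -> K) (g : K -> H) : Prop :=
  forall x y, inner K (f x) y = inner H x (g y).

Definition coisometry (R : realType) (H K : hilbert R) (f : H -> K) : Prop :=
  [/\ linear f, continuous f & exists2 g, is_adjoint f g & f \o g = id].

Record coiso (R : realType) (H K : hilbert R) := Coiso {
  coiso_fun :> H -> K;
  coisoP : coisometry coiso_fun
}.

(* The adjoint is unique ([adjoint_unique]); the default value 0 is never used
   on coisometries ([daggerP]). *)
Definition dagger (R : realType) (H K : hilbert R) (f : H -> K) : K -> H :=
  xget (fun=> 0) [set g | is_adjoint f g].

Section CoisoFacts.
Variable R : realType.
Implicit Types H K L : hilbert R.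

Lemma adjoint_unique H K (f : H -> K) (g h : K -> H) :
  is_adjoint f g -> is_adjoint f h -> g = h.
Proof.
move=> fg fh; apply/funext => y; apply/eqP; rewrite -subr_eq0.
apply: contraT => /(@neq0_dnorm_gt0 _ _ _ (inner H)).
by rewrite linearBr /= -fg -fh subrr ltxx.
Qed.

Lemma daggerP H K (f : coiso H K) : is_adjoint f (dagger f).
Proof. by case: (coisoP f) => _ _ [g fg _]; rewrite /dagger; case: xgetP => // /(_ g). Qed.

Lemma daggerK H K (f : coiso H K) : f \o dagger f = id.
Proof.
case: (coisoP f) => _ _ [g fg fgK].
by rewrite (adjoint_unique (daggerP f) fg).
Qed.

Lemma coisometry_id H : coisometry (@idfun H).
Proof. by split=> // [x|]; [exact: cvg_id|exists id]. Qed.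

Lemma coisometry_comp H K L (g : K -> L) (f : H -> K) :
  coisometry g -> coisometry f -> coisometry (g \o f).
Proof.
move=> [gl gc [g' gg' gK]] [fl fc [f' ff' fK]]; split.
- by move=> a x y /=; rewrite fl gl.
- by move=> x; apply: continuous_comp; [exact: fc|exact: gc].
- exists (f' \o g'); first by move=> x y /=; rewrite gg' ff'.
  by apply/funext => y /=; rewrite -[f _]/((f \o f') _) fK -[g _]/((g \o g') _) gK.
Qed.

End CoisoFacts.

Record sset := SSet {
  sobj :> nat -> Type;
  sres : forall n, sobj n.+1 -> sobj n
}.

Record smap (X Y : sset) := SMap {
  sfun :> forall n, X n -> Y n;
  smapP : forall n (x : X n.+1), sfun (sres x) = sres (sfun x)
}.

Definition later_obj (X : sset) (n : nat) : Type :=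
  if n is m.+1 then X m else unit.

Definition later_res (X : sset) (n : nat) : later_obj X n.+1 -> later_obj X n :=
  match n return later_obj X n.+1 -> later_obj X n with
  | 0 => fun=> tt
  | m.+1 => @sres X m
  end.

Definition later (X : sset) : sset := SSet (@later_res X).

Definition nu_fun (X : sset) (n : nat) : X n -> later X n :=
  match n return X n -> later X n with
  | 0 => fun=> tt
  | m.+1 => @sres X m
  end.

Lemma nu_res (X : sset) (n : nat) (x : X n.+1) :
  nu_fun (sres x) = sres (nu_fun x).
Proof. by case: n x. Qed.

Definition nu (X : sset) : smap X (later X) := SMap (@nu_res X).

Record scat := SCat {
  scat_ob :> Type;
  shom : scat_ob -> scat_ob -> sset;
  sid : forall X n, shom X X n;
  scomp : forall X Y Z n, shom Y Z n -> shom X Y n -> shom X Z n;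
  sid_res : forall X n, sres (sid X n.+1) = sid X n;
  scomp_res : forall X Y Z n (g : shom Y Z n.+1) (f : shom X Y n.+1),
    sres (scomp g f) = scomp (sres g) (sres f);
  scompA : forall X Y Z W n (h : shom Z W n) (g : shom Y Z n) (f : shom X Y n),
    scomp h (scomp g f) = scomp (scomp h g) f;
  scomp1f : forall X Y n (f : shom X Y n), scomp (sid Y n) f = f;
  scompf1 : forall X Y n (f : shom X Y n), scomp f (sid X n) = f
}.

Record sfunctor (C D : scat) := SFunctor {
  fobj :> C -> D;
  fmap : forall X Y, smap (shom X Y) (shom (fobj X) (fobj Y));
  fmap_id : forall X n, fmap X X n (sid X n) = sid (fobj X) n;
  fmap_comp : forall X Y Z n (g : shom Y Z n) (f : shom X Y n),
    fmap X Z n (scomp g f) = scomp (fmap Y Z n g) (fmap X Y n f)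
}.

Section FunctorComposition.
Variables (C D E : scat) (G : sfunctor D E) (F : sfunctor C D).

Definition fcomp_fmap_fun X Y n (f : shom X Y n) : shom (G (F X)) (G (F Y)) n :=
  fmap G (F X) (F Y) n (fmap F X Y n f).

Lemma fcomp_fmap_res X Y n (f : shom X Y n.+1) :
  fcomp_fmap_fun (sres f) = sres (fcomp_fmap_fun f).
Proof. by rewrite /fcomp_fmap_fun !smapP. Qed.

Lemma fcomp_fmap_id X n : fcomp_fmap_fun (sid X n) = sid (G (F X)) n.
Proof. by rewrite /fcomp_fmap_fun !fmap_id. Qed.

Lemma fcomp_fmap_comp X Y Z n (g : shom Y Z n) (f : shom X Y n) :
  fcomp_fmap_fun (scomp g f) = scomp (fcomp_fmap_fun g) (fcomp_fmap_fun f).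
Proof. by rewrite /fcomp_fmap_fun !fmap_comp. Qed.

Definition fcomp : sfunctor C E :=
  @SFunctor C E (fun X => G (F X)) (fun X Y => SMap (@fcomp_fmap_res X Y))
    fcomp_fmap_id fcomp_fmap_comp.

End FunctorComposition.

Section Power.
Variables (C : scat) (m : nat).
Implicit Types X Y Z W : 'I_m -> C.

Definition pow_hom X Y : sset :=
  @SSet (fun n => forall i, shom (X i) (Y i) n) (fun n f i => sres (f i)).

Definition pow_id X n : pow_hom X X n := fun i => sid (X i) n.

Definition pow_comp X Y Z n (g : pow_hom Y Z n) (f : pow_hom X Y n) :
  pow_hom X Z n := fun i => scomp (g i) (f i).

Lemma pow_id_res X n : sres (pow_id X n.+1) = pow_id X n.
Proof. by apply: functional_extensionality_dep => i; exact: sid_res. Qed.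

Lemma pow_comp_res X Y Z n (g : pow_hom Y Z n.+1) (f : pow_hom X Y n.+1) :
  sres (pow_comp g f) = pow_comp (sres g) (sres f).
Proof. by apply: functional_extensionality_dep => i; exact: scomp_res. Qed.

Lemma pow_compA X Y Z W n (h : pow_hom Z W n) (g : pow_hom Y Z n)
  (f : pow_hom X Y n) : pow_comp h (pow_comp g f) = pow_comp (pow_comp h g) f.
Proof. by apply: functional_extensionality_dep => i; exact: scompA. Qed.

Lemma pow_comp1f X Y n (f : pow_hom X Y n) : pow_comp (pow_id Y n) f = f.
Proof. by apply: functional_extensionality_dep => i; exact: scomp1f. Qed.

Lemma pow_compf1 X Y n (f : pow_hom X Y n) : pow_comp f (pow_id X n) = f.
Proof. by apply: functional_extensionality_dep => i; exact: scompf1. Qed.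

Definition pow : scat :=
  SCat pow_id_res pow_comp_res pow_compA pow_comp1f pow_compf1.

End Power.

(* [slot F i X] is the tuple F with its i-th entry replaced by X. *)
Section Slot.
Variables (C : scat) (m : nat) (F : 'I_m -> C) (i : 'I_m).

Definition slot_obj (X : C) : pow C m := fun j => if j == i then X else F j.

Definition slot_fmap_fun X Y n (f : shom X Y n) :
    shom (slot_obj X) (slot_obj Y) n :=
  fun j => match j == i as b
             return shom (if b then X else F j) (if b then Y else F j) n with
           | true => f
           | false => sid (F j) n
           end.

Lemma slot_fmap_res X Y n (f : shom X Y n.+1) :
  slot_fmap_fun (sres f) = sres (slot_fmap_fun f).
Proof.
apply: functional_extensionality_dep => j.
by rewrite /slot_fmap_fun /= /slot_obj; case: (j == i) => //; rewrite sid_res.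
Qed.

Lemma slot_fmap_id X n : slot_fmap_fun (sid X n) = sid (slot_obj X) n.
Proof.
apply: functional_extensionality_dep => j.
by rewrite /slot_fmap_fun /= /pow_id /slot_obj; case: (j == i).
Qed.

Lemma slot_fmap_comp X Y Z n (g : shom Y Z n) (f : shom X Y n) :
  slot_fmap_fun (scomp g f) = scomp (slot_fmap_fun g) (slot_fmap_fun f).
Proof.
apply: functional_extensionality_dep => j.
rewrite /slot_fmap_fun /= /pow_comp /slot_obj.
by case: (j == i) => //; rewrite scomp1f.
Qed.

Definition slot : sfunctor C (pow C m) :=
  @SFunctor C (pow C m) slot_obj (fun X Y => SMap (@slot_fmap_res X Y))
    slot_fmap_id slot_fmap_comp.

End Slot.

(* [rcons_obj F X] is the (k+1)-tuple (F, X), with X in the last position. *)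
Section Rcons.
Variables (C : scat) (k : nat).

Definition rcons_obj (F : pow C k) (X : C) : pow C k.+1 :=
  fun i => if unlift ord_max i is Some j then F j else X.

Definition rcons_hom (F F' : pow C k) (X X' : C) n
    (f : shom F F' n) (x : shom X X' n) :
    shom (rcons_obj F X) (rcons_obj F' X') n :=
  fun i => match unlift ord_max i as o
             return shom (if o is Some j then F j else X)
                         (if o is Some j then F' j else X') n with
           | Some j => f j
           | None => x
           end.

Lemma rcons_hom_res F F' X X' n (f : shom F F' n.+1) (x : shom X X' n.+1) :
  rcons_hom (sres f) (sres x) = sres (rcons_hom f x).
Proof.
apply: functional_extensionality_dep => i.
by rewrite /rcons_hom /= /rcons_obj; case: (unlift _ i).
Qed.

Lemma rcons_hom_id F X n :
  rcons_hom (sid F n) (sid X n) = sid (rcons_obj F X) n.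
Proof.
apply: functional_extensionality_dep => i.
by rewrite /rcons_hom /= /pow_id /rcons_obj; case: (unlift _ i).
Qed.

Lemma rcons_hom_comp F F' F'' X X' X'' n (g : shom F' F'' n) (y : shom X' X'' n)
  (f : shom F F' n) (x : shom X X' n) :
  rcons_hom (scomp g f) (scomp y x) = scomp (rcons_hom g y) (rcons_hom f x).
Proof.
apply: functional_extensionality_dep => i.
by rewrite /rcons_hom /= /pow_comp /rcons_obj; case: (unlift _ i).
Qed.

Section RconsConst.
Variable F : pow C k.

Lemma rconst_res X Y n (x : shom X Y n.+1) :
  rcons_hom (sid F n) (sres x) = sres (rcons_hom (sid F n.+1) x).
Proof. by rewrite -rcons_hom_res sid_res. Qed.

Lemma rconst_comp X Y Z n (y : shom Y Z n) (x : shom X Y n) :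
  rcons_hom (sid F n) (scomp y x) =
  scomp (rcons_hom (sid F n) y) (rcons_hom (sid F n) x).
Proof. by rewrite -rcons_hom_comp scomp1f. Qed.

(* The functor (F, -) : C -> C^(k+1). *)
Definition rcons_const : sfunctor C (pow C k.+1) :=
  @SFunctor C (pow C k.+1) (rcons_obj F) (fun X Y => SMap (@rconst_res X Y))
    (rcons_hom_id F) rconst_comp.

End RconsConst.

Section Pairing.
Variable E : sfunctor (pow C k) C.

Definition id_pair_fmap_fun F F' n (f : shom F F' n) :
    shom (rcons_obj F (E F)) (rcons_obj F' (E F')) n :=
  rcons_hom f (fmap E F F' n f).

Lemma id_pair_res F F' n (f : shom F F' n.+1) :
  id_pair_fmap_fun (sres f) = sres (id_pair_fmap_fun f).
Proof. by rewrite /id_pair_fmap_fun smapP rcons_hom_res. Qed.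

Lemma id_pair_id F n :
  id_pair_fmap_fun (sid F n) = sid (rcons_obj F (E F)) n.
Proof. by rewrite /id_pair_fmap_fun fmap_id rcons_hom_id. Qed.

Lemma id_pair_comp F F' F'' n (g : shom F' F'' n) (f : shom F F' n) :
  id_pair_fmap_fun (scomp g f) =
  scomp (id_pair_fmap_fun g) (id_pair_fmap_fun f).
Proof. by rewrite /id_pair_fmap_fun fmap_comp rcons_hom_comp. Qed.

(* The functor <id, E> : C^k -> C^(k+1). *)
Definition id_pair : sfunctor (pow C k) (pow C k.+1) :=
  @SFunctor (pow C k) (pow C k.+1) (fun F => rcons_obj F (E F))
    (fun F F' => SMap (@id_pair_res F F')) id_pair_id id_pair_comp.

End Pairing.

End Rcons.

(* The later functor preserves products, so composition acts on later
   hom-presheaves: trivially at stage 0, as in C one stage down afterwards. *)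
Definition later_comp (C : scat) (X Y Z : C) (n : nat) :
    later (shom Y Z) n -> later (shom X Y) n -> later (shom X Z) n :=
  match n return later (shom Y Z) n -> later (shom X Y) n ->
                 later (shom X Z) n with
  | 0 => fun _ _ => tt
  | m.+1 => fun g f => @scomp C X Y Z m g f
  end.

Definition later_id (C : scat) (X : C) (n : nat) : later (shom X X) n :=
  nu (shom X X) n (sid X n).

Definition locally_contractive1 (C : scat) (F : sfunctor C C) : Prop :=
  exists G : forall X Y : C, smap (later (shom X Y)) (shom (F X) (F Y)),
    [/\ forall X Y n (f : shom X Y n), fmap F X Y n f = G X Y n (nu _ n f),
        forall X Y Z n (g : later (shom Y Z) n) (f : later (shom X Y) n),
          G X Z n (later_comp g f) = scomp (G Y Z n g) (G X Y n f)
      & forall X n, G X X n (later_id X n) = sid (F X) n].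

(* The entry F i is overwritten by [slot], so F is a choice of objects in all
   arguments but the i-th. *)
Definition locally_contractive (C : scat) (m : nat) (T : sfunctor (pow C m) C) :
    Prop :=
  forall (F : 'I_m -> C) (i : 'I_m), locally_contractive1 (fcomp T (slot F i)).

Record nobj (R : realType) := NObj {
  nspace :> nat -> hilbert R;
  nres : forall n, coiso (nspace n.+1) (nspace n)
}.

Record nmor (R : realType) (X Y : nobj R) := NMor {
  ncomp :> forall n, coiso (X n) (Y n);
  nmorP : forall n, nres Y n \o ncomp n.+1 = ncomp n \o nres X n
}.

Section NCategory.
Variable R : realType.
Implicit Types X Y Z W : nobj R.

Lemma nid_natural X n : nres X n \o id = id \o nres X n.
Proof. by []. Qed.

Definition nid X : nmor X X :=
  @NMor R X X (fun n => Coiso (coisometry_id (X n))) (nid_natural X).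

Definition nmor_comp_fun X Y Z (g : nmor Y Z) (f : nmor X Y) n :
    coiso (X n) (Z n) :=
  Coiso (coisometry_comp (coisoP (g n)) (coisoP (f n))).

Lemma nmor_comp_natural X Y Z (g : nmor Y Z) (f : nmor X Y) n :
  nres Z n \o nmor_comp_fun g f n.+1 = nmor_comp_fun g f n \o nres X n.
Proof.
apply/funext => x /=.
have /(congr1 (@^~ (f n.+1 x))) /= -> := nmorP g n.
by have /(congr1 (@^~ x)) /= -> := nmorP f n.
Qed.

Definition nmor_comp X Y Z (g : nmor Y Z) (f : nmor X Y) : nmor X Z :=
  NMor (nmor_comp_natural g f).

(* A coisometry X n -> Y n that extends to no natural transformation X -> Y
   (possibly because there are none) is not an element of the hom-presheaf. *)
Definition is_ncomp X Y n (h : X n -> Y n) : Prop :=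
  exists f : nmor X Y, h = f n.

Definition nhom_obj X Y n : Type := {h : X n -> Y n | is_ncomp h}.

Lemma nhom_eq X Y n (h h' : nhom_obj X Y n) : sval h = sval h' -> h = h'.
Proof. by case: h h' => [h hP] [h' hP'] /=; exact: eq_exist. Qed.

Lemma nhom_res_subproof X Y n (h : nhom_obj X Y n.+1) :
  is_ncomp (nres Y n \o sval h \o dagger (nres X n)).
Proof.
case: h => h' hP /=; case: hP => [f ->]; exists f.
by rewrite nmorP -compA daggerK.
Qed.

Definition nhom_res X Y n (h : nhom_obj X Y n.+1) : nhom_obj X Y n :=
  exist _ (nres Y n \o sval h \o dagger (nres X n)) (nhom_res_subproof h).

Definition nhom X Y : sset := SSet (@nhom_res X Y).

Definition nat_comp X Y (f : nmor X Y) n : nhom X Y n :=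
  exist _ (coiso_fun (f n)) (ex_intro _ f erefl).

Definition nhom_id X n : nhom X X n := nat_comp (nid X) n.

Lemma nhom_comp_subproof X Y Z n (g : nhom Y Z n) (f : nhom X Y n) :
  is_ncomp (sval g \o sval f).
Proof.
case: g f => [g' gP] [f' fP] /=; case: gP fP => [g ->] [f ->].
by exists (nmor_comp g f).
Qed.

Definition nhom_comp X Y Z n (g : nhom Y Z n) (f : nhom X Y n) : nhom X Z n :=
  exist _ (sval g \o sval f) (nhom_comp_subproof g f).

Lemma nat_comp_res X Y (f : nmor X Y) n :
  sres (nat_comp f n.+1) = nat_comp f n.
Proof. by apply: nhom_eq; rewrite /= nmorP -compA daggerK. Qed.

Lemma nhom_id_res X n : sres (nhom_id X n.+1) = nhom_id X n.
Proof. exact: nat_comp_res. Qed.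

Lemma nhom_comp_res X Y Z n (g : nhom Y Z n.+1) (f : nhom X Y n.+1) :
  sres (nhom_comp g f) = nhom_comp (sres g) (sres f).
Proof.
have res_nat (U V : nobj R) (h : nmor U V) :
    nres V n \o h n.+1 \o dagger (nres U n) = h n.
  by rewrite nmorP -compA daggerK.
case: g f => [g' gP] [f' fP]; apply: nhom_eq => /=.
case: gP fP => [g ->] [f ->].
by rewrite (res_nat _ _ g) (res_nat _ _ f); exact: (res_nat X Z (nmor_comp g f)).
Qed.

Lemma nhom_compA X Y Z W n (h : nhom Z W n) (g : nhom Y Z n) (f : nhom X Y n) :
  nhom_comp h (nhom_comp g f) = nhom_comp (nhom_comp h g) f.
Proof. exact: nhom_eq. Qed.

Lemma nhom_comp1f X Y n (f : nhom X Y n) : nhom_comp (nhom_id Y n) f = f.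
Proof. exact: nhom_eq. Qed.

Lemma nhom_compf1 X Y n (f : nhom X Y n) : nhom_comp f (nhom_id X n) = f.
Proof. exact: nhom_eq. Qed.

Definition ncat : scat :=
  SCat nhom_id_res nhom_comp_res nhom_compA nhom_comp1f nhom_compf1.

Definition is_niso X Y (f : nmor X Y) : Prop :=
  exists2 g : nmor Y X, nmor_comp g f = nid X & nmor_comp f g = nid Y.

End NCategory.

Definition is_fixed_point (R : realType) (F : sfunctor (ncat R) (ncat R))
    (X : nobj R) (alpha : nmor (F X) X) : Prop := is_niso alpha.

Record nat_iso (R : realType) (C : scat) (P Q : sfunctor C (ncat R)) := NatIso {
  niso_comp :> forall X : C, nmor (P X) (Q X);
  niso_natural : forall (X Y : C) n (f : shom X Y n),
    scomp (nat_comp (niso_comp Y) n : shom (P Y) (Q Y) n) (fmap P X Y n f) =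
    scomp (fmap Q X Y n f) (nat_comp (niso_comp X) n : shom (P X) (Q X) n);
  niso_iso : forall X, is_niso (niso_comp X)
}.

(* Main.v *)
From HB Require Import structures.
From mathcomp Require Import all_boot all_order all_algebra.
From mathcomp Require Import sesquilinear complex.
From mathcomp Require Import all_classical all_reals all_analysis.
Require Import Defs.

(** A locally contractive functor only sees a morphism one stage down. Hence in
    the terminal sequence A_0 = 1, A_(n+1) = T(F, A_n), the projection
    A_(n+2) -> A_(n+1) is invertible up to stage n, and the sequence has a
    limit, given at stage n by the n-th component of A_(n+1). Applying T(F, -) only
    shifts the sequence, so this limit is a fixed point, and it is functorial in
    F because every A_n is. The terminal object is the zero space. It also
    settles stage 0, where there may be no morphism X -> Y at all: T inverts
    every morphism to 1 there, so TX and TY are isomorphic at stage 0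
    through T1. *)

Set Implicit Arguments.
Unset Strict Implicit.
Unset Printing Implicit Defensive.

(** * Isomorphisms at a stage *)

Section Isomorphisms.
Variable C : scat.
Implicit Types X Y Z : C.

Definition siso X Y n (f : shom X Y n) : Prop :=
  exists2 g : shom Y X n, scomp g f = sid X n & scomp f g = sid Y n.

Definition sinv X Y n (f : shom X Y n) (fI : siso f) : shom Y X n :=
  s2val (cid2 fI).

Lemma sinvK X Y n (f : shom X Y n) (fI : siso f) : scomp (sinv fI) f = sid X n.
Proof. exact: (s2valP (cid2 fI)). Qed.

Lemma sinvKV X Y n (f : shom X Y n) (fI : siso f) : scomp f (sinv fI) = sid Y n.
Proof. exact: (s2valP' (cid2 fI)). Qed.

Lemma siso_inv X Y n (f : shom X Y n) (fI : siso f) : siso (sinv fI).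
Proof. by exists f; rewrite ?sinvK ?sinvKV. Qed.

Lemma siso_id X n : siso (sid X n).
Proof. by exists (sid X n); rewrite scomp1f. Qed.

Lemma siso_comp X Y Z n (g : shom Y Z n) (f : shom X Y n) :
  siso g -> siso f -> siso (scomp g f).
Proof.
move=> [g' g'K gK] [f' f'K fK]; exists (scomp f' g').
  by rewrite -scompA (scompA g') g'K scomp1f.
by rewrite -scompA (scompA f) fK scomp1f.
Qed.

Lemma siso_inj X Y Z n (f : shom Y Z n) (g h : shom X Y n) :
  siso f -> scomp f g = scomp f h -> g = h.
Proof.
move=> [f' f'K _] fgh.
by rewrite -[g]scomp1f -[h]scomp1f -f'K -!scompA fgh.
Qed.

(* A morphism of the underlying category, i.e. a global element of the
   hom-presheaf. *)
Record gmor X Y := GMor {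
  gmor_fun :> forall n, shom X Y n;
  gmorP : forall n, sres (gmor_fun n.+1) = gmor_fun n
}.

Lemma ginv_res X Y (f : gmor X Y) (fI : forall n, siso (f n)) n :
  sres (sinv (fI n.+1)) = sinv (fI n).
Proof.
apply: (siso_inj (fI n)); rewrite sinvKV -gmorP -scomp_res.
by rewrite sinvKV sid_res.
Qed.

Definition ginv X Y (f : gmor X Y) (fI : forall n, siso (f n)) : gmor Y X :=
  GMor (ginv_res fI).

End Isomorphisms.

Lemma siso_fmap (C D : scat) (S : sfunctor C D) X Y n (f : shom X Y n) :
  siso f -> siso (fmap S X Y n f).
Proof.
move=> [g gK fK]; exists (fmap S Y X n g).
  by rewrite -fmap_comp gK fmap_id.
by rewrite -fmap_comp fK fmap_id.
Qed.

Lemma pow_siso (C : scat) m (A B : pow C m) n (f : shom A B n) :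
  (forall i, siso (f i : shom (A i) (B i) n)) -> siso f.
Proof.
move=> fI; exists (fun i => sinv (fI i));
  apply: functional_extensionality_dep => i.
  exact: sinvK.
exact: sinvKV.
Qed.

(* Local contractiveness as a property: when hom-presheaves have surjective
   restrictions and there is a terminal object, the family G of
   [locally_contractive1] is determined by the functor. *)
Definition contractive (D C : scat) (S : sfunctor D C) : Prop :=
  (forall X Y n (f f' : shom X Y n.+1),
     sres f = sres f' -> fmap S X Y n.+1 f = fmap S X Y n.+1 f') /\
  (forall X Y (f : shom X Y 0), siso (fmap S X Y 0 f)).

Lemma contractive_fcomp (B D C : scat) (S : sfunctor D C) (P : sfunctor B D) :
  contractive S -> contractive (fcomp S P).
Proof.
move=> [Sres S0]; split=> [X Y n f f' ff'|X Y f]; last exact: S0.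
by apply: Sres; rewrite -!smapP ff'.
Qed.

(** At stage n+1, [nu] is the restriction. At stage 0 the later hom-presheaves are singletons, so
    functoriality of [G] makes its values at [tt] in the two directions mutually inverse. *)
Lemma locally_contractive1_contractive (C : scat) (S : sfunctor C C) :
  locally_contractive1 S -> contractive S.
Proof.
move=> [G [GE Gcomp Gid]]; split=> [X Y n f f' ff'|X Y f].
  by rewrite !GE; congr (G X Y n.+1 _).
exists (G Y X 0 tt); rewrite GE -Gcomp; [exact: (Gid X 0)|exact: (Gid Y 0)].
Qed.

(** * Contractiveness in each variable and jointly *)

Section SlotDecomposition.
Variables (C : scat) (m : nat) (j : 'I_m).
Implicit Types A B : pow C m.

(** An identity, retyped: [A l] and the entry of the slot at [l] agree only along [l = j], hence the
    dependent match on the reflection proof. *)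
Definition slot_in A n : shom A (slot_obj A j (A j)) n :=
  fun l => match @eqP _ l j in reflect _ b
             return shom (A l) (if b then A j else A l) n with
           | ReflectT e => match e in _ = i return shom (A l) (A i) n with
                           | erefl => sid (A l) n
                           end
           | ReflectF _ => sid (A l) n
           end.

Definition slot_rest A B n (f : shom A B n) : shom (slot_obj A j (B j)) B n :=
  fun l => match @eqP _ l j in reflect _ b
             return shom (if b then B j else A l) (B l) n with
           | ReflectT e => match e in _ = i return shom (B i) (B l) n with
                           | erefl => sid (B l) n
                           end
           | ReflectF _ => f l
           end.

(** Coordinate [j] moves first, through the slot, where contractiveness in one variable applies; the
    others move afterwards. *)
Lemma slot_decomp A B n (f : shom A B n) :
  f = scomp (slot_rest f) (scomp (fmap (slot A j) (A j) (B j) n (f j))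
                                 (slot_in A n)).
Proof.
apply: functional_extensionality_dep => l.
rewrite /= /pow_comp /slot_rest /slot_in /slot_fmap_fun /slot_obj.
move: (l == j) (@eqP _ l j) => b [e|_]; last by rewrite !scompf1.
by case: _ / e; rewrite scomp1f scompf1.
Qed.

Lemma slot_in_siso A n l :
  siso (slot_in A n l : shom (A l) (slot_obj A j (A j) l) n).
Proof.
rewrite /slot_in /slot_obj.
move: (l == j) (@eqP _ l j) => b [e|_]; last exact: siso_id.
by case: _ / e; exact: siso_id.
Qed.

Lemma slot_rest_siso A B n (f : shom A B n) l :
  (l <> j -> siso (f l : shom (A l) (B l) n)) ->
  siso (slot_rest f l : shom (slot_obj A j (B j) l) (B l) n).
Proof.
rewrite /slot_rest /slot_obj.
move: (l == j) (@eqP _ l j) => b [e _|ne fI]; last exact: fI.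
by case: _ / e; exact: siso_id.
Qed.

Lemma slot_rest_eq A B n (f f' : shom A B n) l :
  (l <> j -> f l = f' l) -> slot_rest f l = slot_rest f' l.
Proof.
rewrite /slot_rest /slot_obj.
by move: (l == j) (@eqP _ l j) => b [|ne ff'] //; exact: ff'.
Qed.

Lemma slot_rest_res A B n (f f' : shom A B n.+1) :
  sres f = sres f' -> sres (slot_rest f) = sres (slot_rest f').
Proof.
move=> ff'; apply: functional_extensionality_dep => l.
move: (congr1 (fun g : shom A B n => g l) ff'); rewrite /= /slot_rest /slot_obj.
by move: (l == j) (@eqP _ l j) => b [].
Qed.

End SlotDecomposition.

Section JointContractiveness.
Variables (C : scat) (m : nat) (T : sfunctor (pow C m) C).
Hypothesis Tlc : locally_contractive T.

Let Tslot A j : contractive (fcomp T (slot A j)).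
Proof. exact/locally_contractive1_contractive/Tlc. Qed.

(* The arguments are changed one at a time, from the last to the first. *)
Let T_res j (A B : pow C m) n (f f' : shom A B n.+1) :
  (forall l : 'I_m, j <= l -> f l = f' l) -> sres f = sres f' ->
  fmap T A B n.+1 f = fmap T A B n.+1 f'.
Proof.
elim: j A B f f' => [|j IH] A B f f' ff' rff'.
  congr (fmap T A B _ _); apply: functional_extensionality_dep => l.
  exact: ff'.
(* If [m <= j], no coordinate has index [j] or more, and the premise of the induction hypothesis is
   vacuous. *)
have [mj|jm] := leqP m j.
  apply: IH => // l jl.
  by have := leq_ltn_trans (leq_trans mj jl) (ltn_ord l); rewrite ltnn.
pose i := Ordinal jm; rewrite (slot_decomp i f) (slot_decomp i f') !fmap_comp.
congr scomp; last congr scomp.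
  (* Both rests are the identity at [j], so they agree from [j] on and not only beyond it. *)
  apply: IH; last exact: slot_rest_res.
  move=> l jl; apply: slot_rest_eq => li; apply: ff'.
  by rewrite ltn_neqAle jl andbT; apply/eqP => jE; apply: li; exact: val_inj.
by apply: (Tslot A i).1; exact: (congr1 (fun g : shom A B n => g i) rff').
Qed.

(** The same induction at stage 0, where invertibility of a coordinate replaces agreement of two. *)
Let T_siso j (A B : pow C m) (f : shom A B 0) :
  (forall l : 'I_m, j <= l -> siso (f l : shom (A l) (B l) 0)) ->
  siso (fmap T A B 0 f).
Proof.
elim: j A B f => [|j IH] A B f fI.
  by apply/siso_fmap/pow_siso => l; exact: fI.
have [mj|jm] := leqP m j.
  apply: IH => // l jl.
  by have := leq_ltn_trans (leq_trans mj jl) (ltn_ord l); rewrite ltnn.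
pose i := Ordinal jm; rewrite (slot_decomp i f) !fmap_comp.
apply: siso_comp; last apply: siso_comp.
- apply: IH => l jl; apply: slot_rest_siso => li; apply: fI.
  by rewrite ltn_neqAle jl andbT; apply/eqP => jE; apply: li; exact: val_inj.
- exact: (Tslot A i).2.
- exact/siso_fmap/pow_siso/slot_in_siso.
Qed.

Lemma locally_contractive_contractive : contractive T.
Proof.
split=> [A B n f f' rff'|A B f].
  by apply: (T_res (j := m)) => // l; rewrite leqNgt ltn_ord.
by apply: (T_siso (j := m)) => l; rewrite leqNgt ltn_ord.
Qed.

End JointContractiveness.

(** * From contractiveness back to local contractiveness *)

Section ContractiveFunctors.
Variable C : scat.
Hypothesis lift : forall (X Y : C) n (f : shom X Y n),
  exists g : shom X Y n.+1, sres g = f.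

(** The inverse of [sres f] lifts to stage n+1. The lift inverts [f] only up to restriction, which
    is all that [S] sees. *)
Lemma contractive_siso (S : sfunctor C C) X Y n (f : shom X Y n.+1) :
  contractive S -> siso (sres f) -> siso (fmap S X Y n.+1 f).
Proof.
move=> [Sres _] [g gK fK]; have [h hg] := lift g.
exists (fmap S Y X n.+1 h); rewrite -fmap_comp -fmap_id.
  by apply: Sres; rewrite scomp_res hg gK sid_res.
by apply: Sres; rewrite scomp_res hg fK sid_res.
Qed.

Variables (one : C) (bang : forall X n, shom X one n).
Hypothesis one_eq : forall X n (f g : shom X one n), f = g.

(* The hom-presheaf may be empty at stage 0; the structure map there is then
   forced to be the zigzag through the terminal object. *)
Lemma contractive_locally_contractive1 (S : sfunctor C C) :
  contractive S -> locally_contractive1 S.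
Proof.
move=> Sc; have [Sres S0] := Sc.
pose up X Y n (f : shom X Y n) : shom X Y n.+1 := sval (cid (lift f)).
have upK X Y n (f : shom X Y n) : sres (up X Y n f) = f := svalP (cid (lift f)).
pose zig X Y : shom (S X) (S Y) 0 :=
  scomp (sinv (S0 Y one (bang Y 0))) (fmap S X one 0 (bang X 0)).
(* [S] inverts the map from [Y] to [one] at stage 0, so a morphism into [S Y] is determined by its
   composite to [S one]. *)
have zigP X Y (g : shom (S X) (S Y) 0) :
    scomp (fmap S Y one 0 (bang Y 0)) g = fmap S X one 0 (bang X 0) ->
    zig X Y = g.
  by move=> gE; rewrite /zig -gE scompA sinvK scomp1f.
have zigE X Y (f : shom X Y 0) : zig X Y = fmap S X Y 0 f.
  by apply: zigP; rewrite -fmap_comp; congr (fmap S X one 0 _); exact: one_eq.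
pose G0 X Y n : later (shom X Y) n -> shom (S X) (S Y) n :=
  match n return later (shom X Y) n -> shom (S X) (S Y) n with
  | 0 => fun=> zig X Y
  | n'.+1 => fun f => fmap S X Y n'.+1 (up X Y n' f)
  end.
have G0res X Y n (f : later (shom X Y) n.+1) :
    G0 X Y n (sres f) = sres (G0 X Y n.+1 f).
  case: n f => [|n] f /=; rewrite -smapP; first exact: zigE.
  by apply: Sres; rewrite !upK.
exists (fun X Y => SMap (G0res X Y)); split.
- move=> X Y [|n] f /=; first exact/esym/zigE.
  by apply: Sres; rewrite upK.
- move=> X Y Z [|n] g f /=.
    by apply: zigP; rewrite /zig !scompA sinvKV scomp1f sinvKV scomp1f.
  by rewrite -fmap_comp; apply: Sres; rewrite scomp_res !upK.
- move=> X [|n] /=; first by apply: zigP; rewrite scompf1.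
  by rewrite -fmap_id; apply: Sres; exact: upK.
Qed.

End ContractiveFunctors.

(** * Parameterised fixed points *)

(* Universality of the cone is no field because [tl_siso] implies it. *)
Record tower_limit (C : scat) (A : nat -> C)
    (p : forall n, gmor (A n.+1) (A n)) := TowerLimit {
  tl_obj :> C;
  tl_proj : forall n, gmor tl_obj (A n);
  tl_projS : forall n s, scomp (p n s) (tl_proj n.+1 s) = tl_proj n s;
  tl_siso : forall n, siso (tl_proj n.+1 n)
}.

Section ConstFunctor.
Variables (D C : scat) (X : C).

Let cst_res n : sid X n = sres (sid X n.+1).
Proof. by rewrite sid_res. Qed.

Let cst_comp n : sid X n = scomp (sid X n) (sid X n).
Proof. by rewrite scomp1f. Qed.

Definition cst_functor : sfunctor D C :=
  @SFunctor D C (fun=> X)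
    (fun Y Z => @SMap (shom Y Z) (shom X X) (fun n _ => sid X n)
                  (fun n _ => cst_res n))
    (fun _ _ => erefl) (fun _ _ _ n _ _ => cst_comp n).

End ConstFunctor.

Section ParameterisedFixedPoint.
Variables (C : scat) (k : nat) (T : sfunctor (pow C k.+1) C).
Hypothesis lift : forall (X Y : C) n (f : shom X Y n),
  exists g : shom X Y n.+1, sres g = f.
Variables (one : C) (bang : forall X n, shom X one n).
Hypothesis one_eq : forall X n (f g : shom X one n), f = g.
Hypothesis limit : forall (A : nat -> C) (p : forall n, gmor (A n.+1) (A n)),
  (forall n, siso (p n.+1 n)) -> tower_limit p.
Hypothesis Tc : contractive T.
Implicit Types F : pow C k.

Definition fmap_rcons F F' X X' n (f : shom F F' n) (x : shom X X' n) :
    shom (T (rcons_obj F X)) (T (rcons_obj F' X')) n :=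
  fmap T (rcons_obj F X) (rcons_obj F' X') n (rcons_hom f x).

Lemma fmap_rcons_comp F F' F'' X X' X'' n
    (g : shom F' F'' n) (y : shom X' X'' n)
    (f : shom F F' n) (x : shom X X' n) :
  scomp (fmap_rcons g y) (fmap_rcons f x) = fmap_rcons (scomp g f) (scomp y x).
Proof. by rewrite /fmap_rcons -fmap_comp rcons_hom_comp. Qed.

Lemma fmap_rcons_res F F' X X' n (f : shom F F' n.+1) (x : shom X X' n.+1) :
  sres (fmap_rcons f x) = fmap_rcons (sres f) (sres x).
Proof. by rewrite /fmap_rcons -smapP rcons_hom_res. Qed.

Lemma fmap_rcons_gmor_subproof F X X' (x : gmor X X') n :
  sres (fmap_rcons (sid F n.+1) (x n.+1)) = fmap_rcons (sid F n) (x n).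
Proof. by rewrite fmap_rcons_res sid_res gmorP. Qed.

Definition fmap_rcons_gmor F X X' (x : gmor X X') :
    gmor (T (rcons_obj F X)) (T (rcons_obj F X')) :=
  GMor (fmap_rcons_gmor_subproof F x).

Lemma fmap_rcons_siso0 F X X' (x : shom X X' 0) :
  siso (fmap_rcons (sid F 0) x).
Proof. exact: Tc.2. Qed.

Lemma fmap_rcons_sisoS F X X' n (x : shom X X' n.+1) :
  siso (sres x) -> siso (fmap_rcons (sid F n.+1) x).
Proof.
exact: (@contractive_siso C lift (fcomp T (rcons_const F)) X X' n x
         (contractive_fcomp _ Tc)).
Qed.

Lemma bang_res X n : sres (bang X n.+1) = bang X n.
Proof. exact: one_eq. Qed.

(** The terminal sequence A_n, built as functors of [F] so that the limit inherits functoriality. *)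
Fixpoint approx n : sfunctor (pow C k) C :=
  if n is n'.+1 then fcomp T (id_pair (approx n')) else cst_functor _ one.

Fixpoint approx_proj F n : gmor (approx n.+1 F) (approx n F) :=
  match n return gmor (approx n.+1 F) (approx n F) with
  | 0 => GMor (bang_res _)
  | n'.+1 => fmap_rcons_gmor F (approx_proj F n')
  end.

Lemma approx_proj_natural F F' m n (f : shom F F' n) :
  scomp (approx_proj F' m n) (fmap (approx m.+1) F F' n f) =
  scomp (fmap (approx m) F F' n f) (approx_proj F m n).
Proof.
elim: m => [|m IH]; first exact: one_eq.
rewrite [LHS]fmap_rcons_comp [RHS]fmap_rcons_comp.
by rewrite scomp1f scompf1 IH.
Qed.

(** One application of [T] makes the projection invertible at stage 0, and each further one raises
    the stage by one. *)
Lemma approx_proj_siso F n : siso (approx_proj F n.+1 n).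
Proof.
elim: n => [|n IH]; first exact: fmap_rcons_siso0.
by apply: fmap_rcons_sisoS; rewrite gmorP.
Qed.

Definition fix_limit F : tower_limit (approx_proj F) :=
  limit (approx_proj_siso F).

Local Notation fixo F := (tl_obj (fix_limit F)).
Local Notation proj F := (tl_proj (fix_limit F)).
Local Notation projI F := (tl_siso (fix_limit F)).

(** At stage n the limit is identified with A_(n+1), the least index whose projection is known to be
    invertible there. *)
Definition fix_fmap_fun F F' n (f : shom F F' n) : shom (fixo F) (fixo F') n :=
  scomp (sinv (projI F' n))
        (scomp (fmap (approx n.+1) F F' n f) (proj F n.+1 n)).

Lemma proj_fix_fmapS F F' n (f : shom F F' n) :
  scomp (proj F' n.+1 n) (fix_fmap_fun f) =
  scomp (fmap (approx n.+1) F F' n f) (proj F n.+1 n).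
Proof. by rewrite scompA sinvKV scomp1f. Qed.

(** Serves compatibility with restriction: the action at stage n+1 is defined through A_(n+2) and
    has to be compared with A_(n+1), used at stage n. *)
Lemma proj_fix_fmap F F' n (f : shom F F' n) :
  scomp (proj F' n n) (fix_fmap_fun f) =
  scomp (fmap (approx n) F F' n f) (proj F n n).
Proof.
rewrite -(tl_projS (fix_limit F')) -(tl_projS (fix_limit F)) -scompA.
by rewrite proj_fix_fmapS !scompA approx_proj_natural.
Qed.

Lemma fix_fmap_res F F' n (f : shom F F' n.+1) :
  fix_fmap_fun (sres f) = sres (fix_fmap_fun f).
Proof.
apply: (siso_inj (projI F' n)).
rewrite proj_fix_fmapS -(gmorP (proj F' n.+1)) -(gmorP (proj F n.+1)).
by rewrite -scomp_res proj_fix_fmap scomp_res smapP.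
Qed.

Lemma fix_fmap_id F n : fix_fmap_fun (sid F n) = sid (fixo F) n.
Proof.
apply: (siso_inj (projI F n)).
by rewrite proj_fix_fmapS fmap_id scomp1f scompf1.
Qed.

Lemma fix_fmap_comp F F' F'' n (g : shom F' F'' n) (f : shom F F' n) :
  fix_fmap_fun (scomp g f) = scomp (fix_fmap_fun g) (fix_fmap_fun f).
Proof.
apply: (siso_inj (projI F'' n)).
rewrite proj_fix_fmapS fmap_comp -scompA -proj_fix_fmapS scompA.
by rewrite -proj_fix_fmapS scompA.
Qed.

Definition fix_functor : sfunctor (pow C k) C :=
  @SFunctor (pow C k) C (fun F => fixo F)
    (fun F F' => SMap (@fix_fmap_res F F'))
    fix_fmap_id fix_fmap_comp.

(** Up to invertible projections, stage n of the functor is [approx n.+1], which is [T] after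
    another functor. *)
Lemma fix_functor_contractive : contractive fix_functor.
Proof.
split=> [F F' n f f' ff'|F F' f].
  apply: (siso_inj (projI F' n.+1)).
  rewrite !proj_fix_fmapS; congr scomp.
  exact: (contractive_fcomp (id_pair (approx n.+1)) Tc).1.
apply: siso_comp; first exact: siso_inv.
by apply: siso_comp; [exact: Tc.2|exact: tl_siso].
Qed.

(** [T(F, -)] sends the projection onto A_n to a map into A_(n+1), which is the limit at stage n. *)
Definition fix_fold_fun F n : shom (T (rcons_obj F (fixo F))) (fixo F) n :=
  scomp (sinv (projI F n)) (fmap_rcons (sid F n) (proj F n n)).

Lemma proj_fix_foldS F n :
  scomp (proj F n.+1 n) (fix_fold_fun F n) = fmap_rcons (sid F n) (proj F n n).
Proof. by rewrite scompA sinvKV scomp1f. Qed.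

Lemma fix_fold_res F n : sres (fix_fold_fun F n.+1) = fix_fold_fun F n.
Proof.
apply: (siso_inj (projI F n)).
rewrite proj_fix_foldS -(gmorP (proj F n.+1)) -scomp_res.
rewrite -(tl_projS (fix_limit F) n.+1 n.+1) -scompA proj_fix_foldS.
rewrite [X in sres X]fmap_rcons_comp scomp1f tl_projS fmap_rcons_res sid_res.
by rewrite gmorP.
Qed.

Definition fix_fold F : gmor (T (rcons_obj F (fixo F))) (fixo F) :=
  GMor (fix_fold_res F).

Lemma fix_fold_siso F n : siso (fix_fold F n).
Proof.
apply: siso_comp; first exact: siso_inv.
(* The projection onto A_n is known to be invertible only below stage n. [T] gains the missing
   stage, and at stage 0 it inverts everything. *)
case: n => [|n]; first exact: fmap_rcons_siso0.
by apply: fmap_rcons_sisoS; rewrite gmorP; exact: tl_siso.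
Qed.

Lemma fix_fold_natural F F' n (f : shom F F' n) :
  scomp (fix_fold F' n) (fmap (fcomp T (id_pair fix_functor)) F F' n f) =
  scomp (fmap fix_functor F F' n f) (fix_fold F n).
Proof.
apply: (siso_inj (projI F' n)).
rewrite -[gmor_fun (fix_fold F') n]/(fix_fold_fun F' n).
rewrite -[gmor_fun (fix_fold F) n]/(fix_fold_fun F n).
rewrite -[fmap fix_functor F F' n f]/(fix_fmap_fun f).
rewrite [LHS]scompA [RHS]scompA proj_fix_foldS proj_fix_fmapS.
rewrite -[RHS]scompA proj_fix_foldS.
rewrite [LHS]fmap_rcons_comp [RHS]fmap_rcons_comp.
by rewrite scomp1f scompf1 proj_fix_fmap.
Qed.

End ParameterisedFixedPoint.

(** * The zero Hilbert space *)

(** An alias indexed by [R], so that structures with scalars [R[i]] attach to it rather than to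
    [unit]. *)
Definition zero_space (R : realType) : Type := unit.

Section ZeroSpace.
Import Order.TTheory GRing.Theory Num.Theory.
Import numFieldNormedType.Exports.
Local Open Scope classical_set_scope.
Local Open Scope ring_scope.
Variable R : realType.
Local Notation Z := (zero_space R).

HB.instance Definition _ := Choice.on Z.

Lemma zero_spaceP (x y : Z) : x = y.
Proof. by case: x; case: y. Qed.

Let zadd (x y : Z) : Z := tt.
Let zopp (x : Z) : Z := tt.
Let zscale (a : R[i]) (x : Z) : Z := tt.
Let znorm (x : Z) : R[i] := 0.

Let zaddA : associative zadd. Proof. by []. Qed.
Let zaddC : commutative zadd. Proof. by []. Qed.
Let zadd0 : left_id (tt : Z) zadd. Proof. by case. Qed.
Let zaddN : left_inverse (tt : Z) zopp zadd. Proof. by []. Qed.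
HB.instance Definition _ := GRing.isZmodule.Build Z zaddA zaddC zadd0 zaddN.

Let zscaleA a b x : zscale a (zscale b x) = zscale (a * b) x. Proof. by []. Qed.
Let zscale1 : left_id 1 zscale. Proof. by case. Qed.
Let zscaleDr : right_distributive zscale +%R. Proof. by []. Qed.
Let zscaleDl x : {morph zscale^~ x : a b / a + b}. Proof. by []. Qed.
HB.instance Definition _ :=
  GRing.Zmodule_isLmodule.Build R[i] Z zscaleA zscale1 zscaleDr zscaleDl.

Let znormD (x y : Z) : znorm (x + y) <= znorm x + znorm y.
Proof. by rewrite addr0. Qed.
Let znormZ (a : R[i]) (x : Z) : znorm (a *: x) = `|a| * znorm x.
Proof. by rewrite mulr0. Qed.
Let znorm0 (x : Z) : znorm x = 0 -> x = 0.
Proof. by move=> _; exact: zero_spaceP. Qed.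
HB.instance Definition _ := Lmodule_isNormed.Build R[i] Z znormD znormZ znorm0.

Let zcomplete (F : set_system Z) : ProperFilter F -> cauchy F -> cvg F.
Proof.
move=> FF _; apply/cvg_ex; exists (0 : Z) => A /nbhs_singleton A0.
by apply: filterS filterT => x _; rewrite (zero_spaceP x 0).
Qed.
HB.instance Definition _ := Uniform_isComplete.Build Z zcomplete.

Definition zero_inner (x y : Z) : R[i] := 0.

Let zinnerl x : zmod_morphism (zero_inner^~ x).
Proof. by move=> y z; rewrite /zero_inner subr0. Qed.
Let zinnerr x : zmod_morphism (zero_inner x).
Proof. by move=> y z; rewrite /zero_inner subr0. Qed.
Let zinnerZl x : scalable_for *%R (zero_inner^~ x).
Proof. by move=> a y; rewrite /zero_inner mulr0. Qed.
Let zinnerZr x : scalable_for (Num.conj \; *%R) (zero_inner x).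
Proof. by move=> a y; rewrite /zero_inner /= mulr0. Qed.
HB.instance Definition _ := @isBilinear.Build R[i] Z Z R[i] *%R
  (Num.conj \; *%R) zero_inner zinnerl zinnerr zinnerZl zinnerZr.
Let zinnerC x y : zero_inner x y = (-1) ^+ false * (zero_inner y x)^*.
Proof. by rewrite /zero_inner mul1r rmorph0. Qed.
HB.instance Definition _ :=
  @isHermitianSesquilinear.Build R[i] Z false Num.conj zero_inner zinnerC.
Let zinner_gt0 x : x != 0 -> 0 < zero_inner x x.
Proof. by rewrite (zero_spaceP x 0) eqxx. Qed.
HB.instance Definition _ := @isDotProduct.Build R[i] Z zero_inner zinner_gt0.

Let zinner_norm (x : Z) : zero_inner x x = `|x| ^+ 2.
Proof. by rewrite (zero_spaceP x 0) normr0 expr0n. Qed.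

Let zcountable :
  exists2 B : set Z, countable B & orthonormal_basis zero_inner B.
Proof.
(* The empty basis spans, since the empty sum is the only vector. *)
exists set0 => //; split=> //; apply/seteqP; split=> // x _.
by apply: subset_closure; exists [::]; split=> //; exact: zero_spaceP.
Qed.

Definition zero_hilbert : hilbert R :=
  @Hilbert R Z (zero_inner : {dot Z for Num.conj}) zinner_norm zcountable.

Lemma zero_coisometry (H : hilbert R) :
  coisometry (fun _ : H => 0 : zero_hilbert).
Proof.
split.
- by move=> a x y; exact: zero_spaceP.
- by move=> x; exact: cvg_cst.
- exists (fun=> 0); last by apply/funext => x; exact: zero_spaceP.
  by move=> x y; rewrite linear0.
Qed.

End ZeroSpace.

(** * Limits of towers in N *)

Section NMorphisms.
Variable R : realType.
Implicit Types X Y : nobj R.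

Lemma nmor_eq X Y (f g : nmor X Y) : (forall n x, f n x = g n x) -> f = g.
Proof.
case: f g => [f fP] [g gP] fg.
have e : f = g.
  apply: functional_extensionality_dep => n; move: (fg n) => /=.
  case: (f n) (g n) => [u uP] [v vP] /= /funext uv; rewrite uv in uP *.
  by rewrite (Prop_irrelevance uP vP).
by rewrite e in fP fg *; rewrite (Prop_irrelevance fP gP).
Qed.

Lemma nmorE X Y (f : nmor X Y) n x : nres Y n (f n.+1 x) = f n (nres X n x).
Proof. exact: (congr1 (@^~ x) (nmorP f n)). Qed.

(** Restrictions are surjective, with section [dagger], so identities pass down. This turns an
    inverse at one stage into an inverse at all lower stages. *)
Lemma nmor_id_le X (f : nmor X X) n s :
  (forall x, f n x = x) -> s <= n -> forall x, f s x = x.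
Proof.
elim: n => [|n IH] fn; first by rewrite leqn0 => /eqP ->.
rewrite leq_eqVlt => /orP[/eqP -> //|]; apply: IH => x.
have rK : nres X n (dagger (nres X n) x) = x.
  exact: (congr1 (@^~ x) (daggerK (nres X n))).
by rewrite -[in LHS]rK -nmorE fn rK.
Qed.

Lemma is_ncomp_coisometry X Y n (h : X n -> Y n) : is_ncomp h -> coisometry h.
Proof. by case=> f ->; exact: coisoP. Qed.

Definition gmor_coiso X Y (f : gmor (C := ncat R) X Y) n : coiso (X n) (Y n) :=
  Coiso (is_ncomp_coisometry (proj2_sig (f n))).

(** Compatibility with restriction leaves a factor [dagger r \o r], which need not be the identity.
    It is absorbed because the component at n+1 extends to a natural transformation [g], along which
    [r] moves past it. *)
Lemma gmor_coiso_natural X Y (f : gmor (C := ncat R) X Y) n :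
  nres Y n \o gmor_coiso f n.+1 = gmor_coiso f n \o nres X n.
Proof.
rewrite /= -(gmorP f n); case: (f n.+1) => h [g /= ->].
by rewrite nmorP -[_ \o dagger _]compA daggerK.
Qed.

Definition nmor_of_gmor X Y (f : gmor (C := ncat R) X Y) : nmor X Y :=
  NMor (gmor_coiso_natural f).

Lemma nat_comp_gmor X Y (f : gmor (C := ncat R) X Y) n :
  nat_comp (nmor_of_gmor f) n = f n.
Proof. exact: nhom_eq. Qed.

Definition gmor_of_nmor X Y (f : nmor X Y) : gmor (C := ncat R) X Y :=
  @GMor (ncat R) X Y (nat_comp f) (nat_comp_res f).

Lemma nmor_of_gmor_iso X Y (f : gmor (C := ncat R) X Y) :
  (forall n, siso (f n)) -> is_niso (nmor_of_gmor f).
Proof.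
move=> fI; exists (nmor_of_gmor (ginv fI)); apply: nmor_eq => n x.
  exact: (congr1 (fun h : nhom X X n => sval h x) (sinvK (fI n))).
exact: (congr1 (fun h : nhom Y Y n => sval h x) (sinvKV (fI n))).
Qed.

(** Elements of the hom-presheaf are components of natural transformations; the next component is a
    lift. *)
Lemma nhom_lift X Y n (f : nhom X Y n) : exists g : nhom X Y n.+1, sres g = f.
Proof.
case: f => h [f hf]; exists (nat_comp f n.+1).
by rewrite nat_comp_res; apply: nhom_eq; exact: esym hf.
Qed.

Definition zero_nobj : nobj R :=
  NObj (fun n => Coiso (zero_coisometry (zero_hilbert R))).

Lemma zero_nmor_natural X n :
  nres zero_nobj n \o Coiso (zero_coisometry (X n.+1)) =
  Coiso (zero_coisometry (X n)) \o nres X n.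
Proof. by []. Qed.

Definition zero_nmor X : nmor X zero_nobj := NMor (@zero_nmor_natural X).

Lemma nhom_zero_eq X n (f g : nhom X zero_nobj n) : f = g.
Proof. by apply: nhom_eq; apply/funext => x; exact: zero_spaceP. Qed.

End NMorphisms.

(** * Diagonal limits of towers and their projections *)

Section NTowers.
Variable R : realType.

(* The offset d makes the class of towers stable under [ntower_shift]. *)
Record ntower (d : nat) := NTower {
  nt_obj :> nat -> nobj R;
  nt_proj : forall m, nmor (nt_obj m.+1) (nt_obj m);
  nt_inc : forall m, nmor (nt_obj m) (nt_obj m.+1);
  nt_incK : forall m s x, s <= m + d -> nt_proj m s (nt_inc m s x) = x;
  nt_projK : forall m s x, s <= m + d -> nt_inc m s (nt_proj m s x) = x
}.

(** The diagonal: at stage m the tower is constant, up to isomorphism, from [Y m] on. *)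
Definition ntower_lim d (Y : ntower d) : nobj R :=
  @NObj R (fun m => Y m m) (fun m =>
    Coiso (coisometry_comp (coisoP (nt_proj Y m m))
                           (coisoP (nres (Y m.+1) m)))).

Section Shift.
Variables (d : nat) (Y : ntower d).

Let shift_incK m s x : s <= m + d.+1 ->
  nt_proj Y m.+1 s (nt_inc Y m.+1 s x) = x.
Proof. by rewrite -addSnnS; exact: nt_incK. Qed.

Let shift_projK m s x : s <= m + d.+1 ->
  nt_inc Y m.+1 s (nt_proj Y m.+1 s x) = x.
Proof. by rewrite -addSnnS; exact: nt_projK. Qed.

Definition ntower_shift : ntower d.+1 :=
  @NTower d.+1 (fun m => Y m.+1) (fun m => nt_proj Y m.+1)
    (fun m => nt_inc Y m.+1) shift_incK shift_projK.

Let to_shift_natural m :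
  nres (ntower_lim ntower_shift) m \o nt_inc Y m.+1 m.+1 =
  nt_inc Y m m \o nres (ntower_lim Y) m.
Proof.
apply/funext => x /=; rewrite nmorE nt_projK ?leq_addr //.
by rewrite nt_incK // addSn leqW // leq_addr.
Qed.

Definition lim_to_shift : nmor (ntower_lim Y) (ntower_lim ntower_shift) :=
  @NMor R (ntower_lim Y) (ntower_lim ntower_shift) (fun m => nt_inc Y m m)
    to_shift_natural.

Let of_shift_natural m :
  nres (ntower_lim Y) m \o nt_proj Y m.+1 m.+1 =
  nt_proj Y m m \o nres (ntower_lim ntower_shift) m.
Proof. by apply/funext => x /=; rewrite nmorE. Qed.

Definition lim_of_shift : nmor (ntower_lim ntower_shift) (ntower_lim Y) :=
  @NMor R (ntower_lim ntower_shift) (ntower_lim Y) (fun m => nt_proj Y m m)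
    of_shift_natural.

Fixpoint nt_proj0 m : nmor (Y m) (Y 0) :=
  match m return nmor (Y m) (Y 0) with
  | 0 => nid (Y 0)
  | m'.+1 => nmor_comp (nt_proj0 m') (nt_proj Y m')
  end.

Fixpoint nt_inc0 m : nmor (Y 0) (Y m) :=
  match m return nmor (Y 0) (Y m) with
  | 0 => nid (Y 0)
  | m'.+1 => nmor_comp (nt_inc Y m') (nt_inc0 m')
  end.

(** Stages up to [d] lie within the bound of every step, so the whole composite cancels, however
    long. *)
Lemma nt_inc0K m s x : s <= d -> nt_proj0 m s (nt_inc0 m s x) = x.
Proof.
by move=> sd; elim: m => //= m IH; rewrite nt_incK // (leq_trans sd) ?leq_addl.
Qed.

Lemma nt_proj0K m s x : s <= d -> nt_inc0 m s (nt_proj0 m s x) = x.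
Proof.
move=> sd; elim: m x => //= m IH x.
by rewrite IH nt_projK // (leq_trans sd) ?leq_addl.
Qed.

Let proj0_natural m :
  nres (Y 0) m \o nt_proj0 m.+1 m.+1 = nt_proj0 m m \o nres (ntower_lim Y) m.
Proof. by apply/funext => x /=; rewrite !nmorE. Qed.

Definition lim_proj0 : nmor (ntower_lim Y) (Y 0) :=
  @NMor R (ntower_lim Y) (Y 0) (fun m => nt_proj0 m m) proj0_natural.

Let inc0_natural m :
  nres (ntower_lim Y) m \o nt_inc0 m.+1 m.+1 = nt_inc0 m m \o nres (Y 0) m.
Proof. by apply/funext => x /=; rewrite !nmorE nt_incK ?leq_addr. Qed.

Definition lim_inc0 : nmor (Y 0) (ntower_lim Y) :=
  @NMor R (Y 0) (ntower_lim Y) (fun m => nt_inc0 m m) inc0_natural.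

End Shift.

(** The composite of projections down to [Y 0] can be peeled at either end. *)
Lemma nt_proj0_shift d (Y : ntower d) m s x :
  nt_proj Y 0 s (nt_proj0 (ntower_shift Y) m s x) =
  nt_proj0 Y m s (nt_proj Y m s x).
Proof. by elim: m x => //= m IH x; rewrite IH. Qed.

(** Shifting [n] times brings index [n] to 0, which avoids comparing the stage with [n]. *)
Fixpoint lim_proj n d (Y : ntower d) : nmor (ntower_lim Y) (Y n) :=
  match n return nmor (ntower_lim Y) (Y n) with
  | 0 => lim_proj0 Y
  | n'.+1 => nmor_comp (lim_proj n' (ntower_shift Y)) (lim_to_shift Y)
  end.

Fixpoint lim_inc n d (Y : ntower d) : nmor (Y n) (ntower_lim Y) :=
  match n return nmor (Y n) (ntower_lim Y) with
  | 0 => lim_inc0 Y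
  | n'.+1 => nmor_comp (lim_of_shift Y) (lim_inc n' (ntower_shift Y))
  end.

(** Each shift moves one unit from the index to the offset and leaves [n + d] unchanged. *)
Lemma lim_incK n d (Y : ntower d) s x : s <= n + d ->
  lim_proj n Y s (lim_inc n Y s x) = x.
Proof.
elim: n d Y x => [|n IH] d Y x snd /=; first exact: nt_inc0K.
by rewrite nt_projK ?leq_addr // IH // addnS.
Qed.

Lemma lim_projK n d (Y : ntower d) s x : s <= n + d ->
  lim_inc n Y s (lim_proj n Y s x) = x.
Proof.
elim: n d Y x => [|n IH] d Y x snd /=; first exact: nt_proj0K.
by rewrite IH ?nt_incK ?leq_addr // addnS.
Qed.

Lemma lim_projS n d (Y : ntower d) s x :
  nt_proj Y n s (lim_proj n.+1 Y s x) = lim_proj n Y s x.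
Proof.
elim: n d Y x => [|n IH] d Y x /=; last exact: (IH _ (ntower_shift Y)).
(* The projection now meets the inclusion of [lim_to_shift] at index [s] and stage [s], where they
   cancel. *)
by rewrite nt_proj0_shift nt_incK ?leq_addr.
Qed.

End NTowers.

(** * The limit in N of a tower whose projections become invertible stage by stage *)

Section NLimits.
Variables (R : realType) (A : nat -> nobj R).
Variable p : forall n, gmor (C := ncat R) (A n.+1) (A n).
Hypothesis pI : forall n, siso (p n.+1 n).

Let P n : nmor (A n.+1) (A n) := nmor_of_gmor (p n).
(** A natural transformation extending the inverse at stage n. Above that stage it is an arbitrary
    choice. *)
Let Q n : nmor (A n.+1) (A n.+2) := sval (cid (proj2_sig (sinv (pI n)))).

Let QE n x : Q n n x = sval (sinv (pI n)) x.
Proof. by rewrite /Q; case: cid => /= q ->. Qed.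

Let QK n s x : s <= n + 0 -> P n.+1 s (Q n s x) = x.
Proof.
rewrite addn0 => sn; apply: (nmor_id_le (f := nmor_comp (P n.+1) (Q n)) _ sn).
move=> {}x; rewrite /= QE.
exact: (congr1 (fun h : nhom (A n.+1) (A n.+1) n => sval h x) (sinvKV (pI n))).
Qed.

Let PK n s x : s <= n + 0 -> Q n s (P n.+1 s x) = x.
Proof.
rewrite addn0 => sn; apply: (nmor_id_le (f := nmor_comp (Q n) (P n.+1)) _ sn).
move=> {}x; rewrite /= QE.
exact: (congr1 (fun h : nhom (A n.+2) (A n.+2) n => sval h x) (sinvK (pI n))).
Qed.

(** The tower starts at [A 1], because the invertible projections start with [p 1] at stage 0. *)
Let Y : ntower R 0 := NTower QK PK.

Let proj n : nmor (ntower_lim Y) (A n) :=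
  if n is n'.+1 then lim_proj n' Y else nmor_comp (P 0) (lim_proj 0 Y).

Let projS n s :
  scomp (p n s) (gmor_of_nmor (proj n.+1) s) = gmor_of_nmor (proj n) s.
Proof.
apply: nhom_eq; apply/funext => x.
by case: n => [|n] //; exact: (@lim_projS R n 0 Y s x).
Qed.

Let proj_siso n : siso (gmor_of_nmor (proj n.+1) n).
Proof.
exists (gmor_of_nmor (lim_inc n Y) n); apply: nhom_eq; apply/funext => x.
  exact: (@lim_projK R n 0 Y n x (leq_addr 0 n)).
exact: (@lim_incK R n 0 Y n x (leq_addr 0 n)).
Qed.

Definition ncat_limit : tower_limit p :=
  @TowerLimit (ncat R) A p (ntower_lim Y)
    (fun n => gmor_of_nmor (proj n)) projS proj_siso.

End NLimits.

Theorem theorem5p30 (R : realType) (k : nat)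
    (T : sfunctor (pow (ncat R) k.+1) (ncat R)) (hT : locally_contractive T) :
  exists (Te : sfunctor (pow (ncat R) k) (ncat R))
         (phi : nat_iso (fcomp T (id_pair Te)) Te),
    locally_contractive Te /\
    forall F : pow (ncat R) k,
      @is_fixed_point R (fcomp T (rcons_const F)) (Te F) (phi F).
Proof.
have Tc := locally_contractive_contractive hT.
pose bang X n : nhom X (zero_nobj R) n := nat_comp (zero_nmor X) n.
pose Te := @fix_functor (ncat R) k T (@nhom_lift R) (zero_nobj R) bang
  (@nhom_zero_eq R) (@ncat_limit R) Tc.
pose u F := @fix_fold (ncat R) k T (@nhom_lift R) (zero_nobj R) bang
  (@nhom_zero_eq R) (@ncat_limit R) Tc F.
have uI F : is_niso (nmor_of_gmor (u F)).
  by apply: nmor_of_gmor_iso => n; exact: fix_fold_siso.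
have uN F F' n (f : shom F F' n) :
    scomp (nat_comp (nmor_of_gmor (u F')) n :
             shom (fcomp T (id_pair Te) F') (Te F') n)
      (fmap (fcomp T (id_pair Te)) F F' n f) =
    scomp (fmap Te F F' n f)
      (nat_comp (nmor_of_gmor (u F)) n :
         shom (fcomp T (id_pair Te) F) (Te F) n).
  by rewrite !nat_comp_gmor; exact: fix_fold_natural.
(* The fixed-point clause unfolds to [uI]. *)
exists Te, (NatIso uN uI); split=> // F i.
(* Filling all slots but one preserves contractiveness, and N has the lifts and the terminal object
   needed to return to local contractiveness. *)
apply: (@contractive_locally_contractive1 (ncat R) (@nhom_lift R) (zero_nobj R)
  bang (@nhom_zero_eq R)).
exact/contractive_fcomp/fix_functor_contractive.
Qed.
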